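(* Let $R\subset A$ be a Frobenius extension of rings and let $M$ be a left $A$-module. If $M$ is Gorenstein projective in $\mathrm{Mod}(A)$, then the underlying left $R$-module $M$ is Gorenstein projective in $\mathrm{Mod}(R)$. The converse (if the underlying left $R$-module $M$ is Gorenstein projective, then $M$ is Gorenstein projective in $\mathrm{Mod}(A)$) holds if $R\subset A$ is either a left-Gorenstein Frobenius extension or a separable Frobenius extension.
   Context: All rings are associative with unit and ring homomorphisms preserve the unit. $\mathrm{Mod}(S)$ is the category of left $S$-modules. A ring extension $R\subset A$ is an injective ring homomorphism $\iota:R\hookrightarrow A$; left $A$-modules are viewed as left $R$-modules by restriction along $\iota$ (the underlying $R$-module), and $A$ is an $R$-$R$-bimodule via $\iota$. A left $S$-module $M$ is Gorenstein projective if there is an acyclic complex $\mathbf{P}=\cdots\to P_1\to P_0\to P_{-1}\to\cdots$ of projective left $S$-modules such that $\mathrm{Hom}_S(\mathbf{P},P)$ is acyclic for every projective left $S$-module $P$ (a totally acyclic complex), with $M=\mathrm{Ker}(P_0\to P_{-1})$. Modules are not assumed finitely generated. $R\subset A$ is a Frobenius extension if one of the following equivalent conditions holds: (1) the functors $A\otimes_R-$ and $\mathrm{Hom}_R(A,-)$ from $\mathrm{Mod}(R)$ to $\mathrm{Mod}(A)$ are naturally equivalent; (2) ${}_RA$ is finitely generated projective and ${}_AA_R\cong\mathrm{Hom}_R({}_RA_A,R)$ as $A$-$R$-bimodules; (3) $A_R$ is finitely generated projective and ${}_RA_A\cong\mathrm{Hom}_{R^{op}}({}_AA_R,R)$ as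 $R$-$A$-bimodules; (4) there exist an $R$-$R$-bimodule homomorphism $\tau:A\to R$ and finitely many elements $x_i,y_i\in A$ such that $\sum_i x_i\tau(y_ia)=a$ and $\sum_i\tau(ax_i)y_i=a$ for all $a\in A$. A ring $\Lambda$ is left-Gorenstein if its global Gorenstein projective dimension is finite, i.e. the supremum over all left $\Lambda$-modules $M$ of the Gorenstein projective dimension of $M$ is finite, where the latter is the least $n$ such that there is an exact sequence $0\to G_n\to\cdots\to G_0\to M\to0$ with all $G_i$ Gorenstein projective. A left-Gorenstein Frobenius extension is a Frobenius extension $R\subset A$ such that in addition $A$ is left-Gorenstein. A ring extension $R\subset A$ is separable if the multiplication map $\varphi:A\otimes_RA\to A$, $a\otimes_R b\mapsto ab$, is a split epimorphism of $A$-bimodules. A separable Frobenius extension is a ring extension that is both Frobenius and separable. *)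

(* Defs.v *)
From HB Require Import structures.
From mathcomp Require Import all_boot all_order all_algebra.
From mathcomp Require Import generic_quotient ring_quotient boolp.
From mathcomp Require Import freeg.

Set Implicit Arguments.
Unset Strict Implicit.
Unset Printing Implicit Defensive.

Import GRing.Theory.

Local Open Scope ring_scope.
Local Open Scope quotient_scope.

(* Rings are [pzRingType]s (the zero ring is allowed), left modules are        *)
(* [lmodType]s, and a ring homomorphism is an [{rmorphism R -> A}].            *)

Definition restrict_scalars (R A : pzRingType) (iota : {rmorphism R -> A})
  (M : lmodType A) : Type := M.

Section RestrictScalars.
Variables (R A : pzRingType) (iota : {rmorphism R -> A}) (M : lmodType A).

Local Notation N := (restrict_scalars iota M).

HB.instance Definition _ := GRing.Zmodule.on N.

Definition restrict_scale (r : R) (m : N) : N := iota r *: (m : M).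

Fact restrict_scaleA a b v :
  restrict_scale a (restrict_scale b v) = restrict_scale (a * b) v.
Proof. by rewrite /restrict_scale rmorphM scalerA. Qed.

Fact restrict_scale1 : left_id 1 restrict_scale.
Proof. by move=> v; rewrite /restrict_scale rmorph1 scale1r. Qed.

Fact restrict_scaleDr : right_distributive restrict_scale +%R.
Proof. by move=> a u v; rewrite /restrict_scale scalerDr. Qed.

Fact restrict_scaleDl v : {morph restrict_scale^~ v : a b / a + b}.
Proof. by move=> a b; rewrite /restrict_scale rmorphD scalerDl. Qed.

HB.instance Definition _ := GRing.Zmodule_isLmodule.Build R N
  restrict_scaleA restrict_scale1 restrict_scaleDr restrict_scaleDl.

End RestrictScalars.

Section GorensteinProjective.
Variable S : pzRingType.

Definition projective (P : lmodType S) : Prop :=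
  forall (X Y : lmodType S) (g : {linear X -> Y}) (f : {linear P -> Y}),
    (forall y, exists x, g x = y) ->
    exists h : {linear P -> X}, forall p, g (h p) = f p.

(* Indexing the differentials as [P (i + 1) -> P i] lets two consecutive ones  *)
(* compose without transporting along [i + 1 - 1 = i].                         *)
Record complex := Complex {
  cobj :> int -> lmodType S;
  cdiff : forall i, {linear cobj (i + 1) -> cobj i};
  cdiffK : forall i x, cdiff i (cdiff (i + 1) x) = 0
}.

(* Exactness at every [P (i + 1)], hence, [i] being an integer, everywhere.    *)
Definition acyclic (P : complex) : Prop :=
  forall i (x : P (i + 1)),
    cdiff P i x = 0 -> exists y, cdiff P (i + 1) y = x.

(* Exactness of Hom(P, Q), whose differentials are precomposition with those   *)
(* of P, at every Hom(P (i + 1), Q).                                           *)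
Definition hom_acyclic (P : complex) (Q : lmodType S) : Prop :=
  forall i (f : {linear P (i + 1) -> Q}),
    (forall y, f (cdiff P (i + 1) y) = 0) ->
    exists g : {linear P i -> Q}, forall x, g (cdiff P i x) = f x.

Definition totally_acyclic (P : complex) : Prop :=
  [/\ forall i, projective (P i),
      acyclic P
    & forall Q : lmodType S, projective Q -> hom_acyclic P Q].

(* [k] identifies M with the kernel of [cdiff P (-1) : P 0 -> P (-1)].         *)
Definition gorenstein_projective (M : lmodType S) : Prop :=
  exists (P : complex) (k : {linear M -> P 0}),
    [/\ totally_acyclic P,
        injective k
      & forall x : P 0, cdiff P (-1) x = 0 <-> exists m, k m = x].

(* An exact sequence 0 -> G n -> ... -> G 0 -> M -> 0 with Gorenstein          *)
(* projective terms, extended by zero modules beyond degree n.                 *)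
Definition gproj_resolution (M : lmodType S) (n : nat) : Prop :=
  exists (G : nat -> lmodType S) (d : forall i, {linear G i.+1 -> G i})
         (e : {linear G 0%N -> M}),
    [/\ forall i, (i <= n)%N -> gorenstein_projective (G i),
        forall i, (n < i)%N -> forall x : G i, x = 0,
        forall m, exists x, e x = m,
        forall x, e x = 0 <-> exists y, d 0%N y = x
      & forall i (x : G i.+1), d i x = 0 <-> exists y, d i.+1 y = x].

(* [gproj_dim M n]: the Gorenstein projective dimension of M is finite and     *)
(* equal to n.                                                                 *)
Definition gproj_dim (M : lmodType S) (n : nat) : Prop :=
  gproj_resolution M n /\ forall m, gproj_resolution M m -> (n <= m)%N.

Definition left_gorenstein : Prop :=
  exists N : nat, forall M : lmodType S, exists2 n, gproj_dim M n & (n <= N)%N.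

End GorensteinProjective.

(* The R-balanced tensor product of A with itself along iota: the free abelian *)
(* group on A * A modulo the subgroup generated by the bilinearity and         *)
(* balancedness relations.                                                     *)
Section Tensor.
Variables (R A : pzRingType) (iota : {rmorphism R -> A}).

Local Notation F := {freeg (A * A)%type}.

Inductive tensor_rel : F -> Prop :=
| TensorRel0 : tensor_rel 0
| TensorRelB u v : tensor_rel u -> tensor_rel v -> tensor_rel (u - v)
| TensorRelDl a a' b :
    tensor_rel (<< (a + a', b) >> - (<< (a, b) >> + << (a', b) >>))
| TensorRelDr a b b' :
    tensor_rel (<< (a, b + b') >> - (<< (a, b) >> + << (a, b') >>))
| TensorRelM a r b :
    tensor_rel (<< (a * iota r, b) >> - << (a, iota r * b) >>).

Definition tensor_pred : {pred F} := fun u => `[< tensor_rel u >].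

Fact tensor_pred_zmod_closed : zmod_closed tensor_pred.
Proof.
split=> [|u v /asboolP hu /asboolP hv]; apply/asboolP; first exact: TensorRel0.
exact: TensorRelB.
Qed.

HB.instance Definition _ :=
  GRing.isZmodClosed.Build F tensor_pred tensor_pred_zmod_closed.

Definition tensor : Type := Quotient.quot tensor_pred.

HB.instance Definition _ := GRing.Zmodule.on tensor.

Definition tens (a b : A) : tensor :=
  \pi_(Quotient.quot tensor_pred) << (a, b) >>.

Definition balanced (V : zmodType) (f : A -> A -> V) : Prop :=
  [/\ forall a a' b, f (a + a') b = f a b + f a' b,
      forall a b b', f a (b + b') = f a b + f a b'
    & forall a r b, f (a * iota r) b = f a (iota r * b)].

Lemma balanced_tens : balanced tens.
Proof.
split=> *; rewrite /tens -?raddfD; apply/eqP;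
  rewrite -[_ == _]Quotient.idealrBE; apply/asboolP.
- exact: TensorRelDl.
- exact: TensorRelDr.
- exact: TensorRelM.
Qed.

(* [tensor_lift f] is the additive map sending [tens a b] to [f a b] when f is *)
(* balanced.                                                                   *)
Definition tensor_lift (V : zmodType) (f : A -> A -> V) (t : tensor) : V :=
  fglift (fun p => f p.1 p.2 : zmodule V) (repr (t : Quotient.quot tensor_pred)).

Section Lift.
Variables (V : zmodType) (f : A -> A -> V) (hf : balanced f).

Local Notation L := (fglift (fun p => f p.1 p.2 : zmodule V)).

Let LB u v : L (u - v) = L u - L v :> V.
Proof. exact: (@lift_is_additive _ _ (zmodule V) _ u v). Qed.

Let L0 : L 0 = 0 :> V.
Proof. by rewrite -[X in L X](subrr 0) LB subrr. Qed.

Let LD u v : L (u + v) = L u + L v :> V.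
Proof. by rewrite -[v in LHS]opprK -[- v]sub0r !LB L0 sub0r opprK. Qed.

Let LU a b : L << (a, b) >> = f a b.
Proof. by rewrite liftU scale1r. Qed.

Let L_rel u : tensor_rel u -> L u = 0 :> V.
Proof.
have [fDl fDr fM] := hf.
elim=> [|{}u v _ hu _ hv|a a' b|a b b'|a r b].
- exact: L0.
- by rewrite LB hu hv subrr.
- by rewrite LB LD !LU fDl subrr.
- by rewrite LB LD !LU fDr subrr.
- by rewrite LB !LU fM subrr.
Qed.

Let L_pi u : tensor_lift f (\pi_(Quotient.quot tensor_pred) u) = L u.
Proof.
apply/eqP; rewrite -subr_eq0 -LB; apply/eqP/L_rel/asboolP.
rewrite -[X in is_true X]/(_ \in tensor_pred) Quotient.idealrBE.
by rewrite reprK.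
Qed.

Lemma tensor_liftE a b : tensor_lift f (tens a b) = f a b.
Proof. by rewrite /tens L_pi LU. Qed.

Lemma tensor_lift_additive : zmod_morphism (tensor_lift f).
Proof.
elim/quotW=> u; elim/quotW=> v.
by rewrite -raddfB !L_pi LB.
Qed.

End Lift.

Lemma tensor_ind (P : tensor -> Prop) :
  P 0 -> (forall t u, P t -> P u -> P (t - u)) -> (forall a b, P (tens a b)) ->
  forall t, P t.
Proof.
move=> P0 PB PU.
have PN t : P t -> P (- t) by rewrite -sub0r; apply: PB.
have PD t u : P t -> P u -> P (t + u).
  by move=> Pt Pu; rewrite -[u]opprK; apply/PB/PN.
have PMn t n : P t -> P (t *+ n).
  by move=> Pt; elim: n => [|n IHn]; rewrite ?mulr0n // mulrS; apply: PD.
have PMz t (k : int) : P t -> P (t *~ k).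
  by case: k => n Pt; [apply: PMn | apply/PN/PMn].
elim/quotW=> u; rewrite -(freeg_sumE u) raddf_sum.
apply: (big_ind P) => // -[a b] _.
have -> : << coeff (a, b) u *g (a, b) >> = << (a, b) >> *~ coeff (a, b) u :> F.
  by rewrite freeg_mulz intz.
by rewrite raddfMz; apply/PMz/PU.
Qed.

(* The A-A-bimodule structure of [tensor]. *)
Definition tensor_actl (a : A) : tensor -> tensor :=
  tensor_lift (fun x y => tens (a * x) y).
Definition tensor_actr (t : tensor) (b : A) : tensor :=
  tensor_lift (fun x y => tens x (y * b)) t.

Definition tensor_mul : tensor -> A := tensor_lift *%R.

Fact balanced_actl a : balanced (fun x y => tens (a * x) y).
Proof.
have [tDl tDr tM] := balanced_tens.
by split=> *; rewrite ?mulrDr ?mulrA ?tDl ?tDr ?tM.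
Qed.

Fact balanced_actr b : balanced (fun x y => tens x (y * b)).
Proof.
have [tDl tDr tM] := balanced_tens.
by split=> *; rewrite ?mulrDl -?mulrA ?tDl ?tDr ?tM.
Qed.

Fact balanced_mul : balanced *%R.
Proof. by split=> *; rewrite ?mulrDl ?mulrDr ?mulrA. Qed.

Lemma tensor_actlE a x y : tensor_actl a (tens x y) = tens (a * x) y.
Proof. exact: tensor_liftE (balanced_actl a) _ _. Qed.

Lemma tensor_actrE x y b : tensor_actr (tens x y) b = tens x (y * b).
Proof. exact: tensor_liftE (balanced_actr b) _ _. Qed.

Lemma tensor_mulE x y : tensor_mul (tens x y) = x * y.
Proof. exact: tensor_liftE balanced_mul _ _. Qed.

End Tensor.

Section Extensions.
Variables (R A : pzRingType) (iota : {rmorphism R -> A}).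

(* A Frobenius homomorphism tau with dual bases x, y. Injectivity of iota is  *)
(* not part of these predicates.                                               *)
Definition frobenius_extension : Prop :=
  exists (tau : {additive A -> R}) (n : nat) (x y : 'I_n -> A),
    [/\ forall r a, tau (iota r * a) = r * tau a,
        forall a r, tau (a * iota r) = tau a * r,
        forall a, \sum_i x i * iota (tau (y i * a)) = a
      & forall a, \sum_i iota (tau (a * x i)) * y i = a].

Definition left_gorenstein_frobenius_extension : Prop :=
  frobenius_extension /\ left_gorenstein A.

(* The multiplication map has a section that is a map of A-A-bimodules. *)
Definition separable_extension : Prop :=
  exists s : {additive A -> tensor iota},
    [/\ forall a x, s (a * x) = tensor_actl a (s x),
        forall x b, s (x * b) = tensor_actr (s x) b
      & forall x, tensor_mul (s x) = x].

Definition separable_frobenius_extension : Prop :=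
  frobenius_extension /\ separable_extension.

End Extensions.

(* Main.v *)
Require Import Defs.
From HB Require Import structures.
From mathcomp Require Import all_boot all_algebra.
From mathcomp Require Import generic_quotient ring_quotient boolp functions.

Set Implicit Arguments.
Unset Strict Implicit.
Unset Printing Implicit Defensive.

Import GRing.Theory.

Local Open Scope ring_scope.
Local Open Scope quotient_scope.

(** Write Res for restriction of scalars along R -> A. For a Frobenius extension
the coinduced module Hom_R(A, Q) is also the induced one ([coind_universal]), so
Res has one exact functor, coinduction, as both its left and its right adjoint;
hence Res and coinduction preserve projectives. Restricting a totally acyclic
complex P of A-modules therefore gives a complex of projectives, and
Hom_R(Res P, Q) = Hom_A(P, Hom_R(A, Q)) is acyclic for Q projective: this is the
direct implication.

For the converse, Gorenstein projectivity is used in a coinductive form. A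
module is Gorenstein projective as soon as it lies in some class X of modules
such that every M in X has a syzygy and a cosyzygy in X and satisfies
Ext^1(M, Q) = 0 for Q projective ([gorenstein_projective_of_class]); the cycles
of a totally acyclic complex form such a class, and splicing short exact
sequences inside X gives the complex back. A first consequence is closure under
retracts ([gorenstein_projective_retract]): by comparison of resolutions, a
syzygy (cosyzygy) of a retract of G is a retract of a syzygy (cosyzygy) of G
plus a projective module, so the retracts of Gorenstein projectives form such a
class.

Now let X be the class of the A-modules M with Res M Gorenstein projective. If
k : Res M -> P embeds Res M in a projective with Gorenstein projective cokernel,
the adjoint M -> Hom_R(A, P) of k is injective, and the same comparison shows
that its cokernel is in X; dually, a projective P mapping onto Res M with
Gorenstein projective kernel gives a surjection Hom_R(A, P) -> M whose kernel is
in X. It remains to see that Ext^1_A(M, Q) = 0 for M in X and Q projective. In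
the separable case, an R-linear extension of an A-linear map is turned into an
A-linear one by averaging over the separability element
([ext1_zero_separable]). In the left-Gorenstein case, a module M of Gorenstein
projective dimension at most n has Ext^(n+1)(M, Q) = 0
([gproj_resolution_ext_zero]); taking n cosyzygies inside X shifts this down to
Ext^1 ([ext1_zero_cosyzygy]). *)

(** * Kernels, cokernels and factorizations *)

Section LinearOf.
Variables (S : pzRingType) (X Y : lmodType S) (f : X -> Y).
Hypothesis f_linear : linear f.

Definition linear_of : {linear X -> Y} :=
  HB.pack f (GRing.isLinear.Build S X Y *:%R f f_linear).

Lemma linear_ofE x : linear_of x = f x.
Proof. by []. Qed.
End LinearOf.

Section Kernel.
Variables (S : pzRingType) (X Y : lmodType S) (g : {linear X -> Y}).

Definition kernel_pred : {pred X} := fun x => g x == 0.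

Fact kernel_submod_closed : submod_closed kernel_pred.
Proof.
split=> [|a u v]; rewrite !unfold_in ?linear0 //.
by move=> /eqP gu /eqP gv; rewrite linearP gu gv scaler0 addr0.
Qed.

HB.instance Definition _ :=
  GRing.isSubmodClosed.Build S X kernel_pred kernel_submod_closed.

Record kernel := Kernel { kernel_val : X; _ : kernel_val \in kernel_pred }.

HB.instance Definition _ := [isSub for kernel_val].
HB.instance Definition _ := [Choice of kernel by <:].
HB.instance Definition _ := [SubChoice_isSubLmodule of kernel by <:].
End Kernel.

Section Cokernel.
Variables (S : pzRingType) (X Y : lmodType S) (g : {linear X -> Y}).

Definition image_pred : {pred Y} := fun y => `[< exists x, g x = y >].

Fact image_zmod_closed : zmod_closed image_pred.
Proof.
split=> [|u v /asboolP[x <-] /asboolP[y <-]]; apply/asboolP.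
  by exists 0; rewrite linear0.
by exists (x - y); rewrite linearB.
Qed.

HB.instance Definition _ :=
  GRing.isZmodClosed.Build Y image_pred image_zmod_closed.

Definition cokernel : Type := Quotient.quot image_pred.

HB.instance Definition _ := GRing.Zmodule.on cokernel.

Definition coker (y : Y) : cokernel := \pi_(Quotient.quot image_pred) y.

Lemma coker_eq u v : coker u = coker v <-> exists x, g x = u - v.
Proof.
rewrite /coker; split=> [/eqP|h]; last apply/eqP.
  by rewrite -[_ == _]Quotient.idealrBE => /asboolP.
by rewrite -[_ == _]Quotient.idealrBE; apply/asboolP.
Qed.

Lemma cokerD u v : coker (u + v) = coker u + coker v.
Proof. by rewrite /coker raddfD. Qed.

Definition coker_scale (a : S) (c : cokernel) : cokernel :=
  coker (a *: repr (c : Quotient.quot image_pred)).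

Lemma coker_scaleE a y : coker_scale a (coker y) = coker (a *: y).
Proof.
apply/coker_eq; have /coker_eq[x gx] : coker (repr (coker y)) = coker y.
  by rewrite /coker reprK.
by exists (a *: x); rewrite linearZ_LR gx scalerBr.
Qed.

Lemma coker_surj c : exists y, coker y = c.
Proof.
by exists (repr (c : Quotient.quot image_pred)); rewrite /coker reprK.
Qed.

Fact coker_scaleA a b c :
  coker_scale a (coker_scale b c) = coker_scale (a * b) c.
Proof. by have [y <-] := coker_surj c; rewrite !coker_scaleE scalerA. Qed.

Fact coker_scale1 : left_id 1 coker_scale.
Proof.
by move=> c; have [y <-] := coker_surj c; rewrite coker_scaleE scale1r.
Qed.

Fact coker_scaleDr : right_distributive coker_scale +%R.
Proof.
move=> a c d; have [u <-] := coker_surj c; have [v <-] := coker_surj d.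
by rewrite -cokerD !coker_scaleE scalerDr cokerD.
Qed.

Fact coker_scaleDl c : {morph coker_scale^~ c : a b / a + b}.
Proof.
by move=> a b; have [u <-] := coker_surj c;
  rewrite !coker_scaleE scalerDl cokerD.
Qed.

HB.instance Definition _ := GRing.Zmodule_isLmodule.Build S cokernel
  coker_scaleA coker_scale1 coker_scaleDr coker_scaleDl.

Fact coker_linear : linear coker.
Proof. by move=> a u v; rewrite cokerD -coker_scaleE. Qed.

HB.instance Definition _ := GRing.isLinear.Build S Y cokernel *:%R coker
  coker_linear.
End Cokernel.

Section Exact.
Variable S : pzRingType.
Implicit Types (K X M Y Q C : lmodType S).

Definition short_exact K X M (k : {linear K -> X})
    (e : {linear X -> M}) : Prop :=
  [/\ injective k, forall m, exists x, e x = m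
    & forall x, e x = 0 <-> exists y, k y = x].

(** Submodules and quotients enter the later arguments only through this
universal property and the dual one. *)
Lemma factor_inj K X Y (k : {linear K -> X}) (f : {linear Y -> X}) :
  injective k -> (forall y, exists x, k x = f y) ->
  exists g : {linear Y -> K}, forall y, k (g y) = f y.
Proof.
move=> kI /choice[g gE].
have gL : linear g by move=> a u v; apply: kI; rewrite !linearP !gE linearP.
by exists (linear_of gL).
Qed.

Lemma factor_surj X M Y (e : {linear X -> M}) (f : {linear X -> Y}) :
  (forall m, exists x, e x = m) -> (forall x, e x = 0 -> f x = 0) ->
  exists g : {linear M -> Y}, forall x, g (e x) = f x.
Proof.
move=> eS ef0; have [s sE] := choice eS.
have gE x : f (s (e x)) = f x.
  by apply/eqP; rewrite -subr_eq0 -linearB; apply/eqP/ef0;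
    rewrite linearB sE subrr.
have gL : linear (f \o s).
  move=> a u v; have [x <-] := eS u; have [y <-] := eS v.
  by rewrite -linearP /= !gE linearP.
by exists (linear_of gL).
Qed.

Lemma kernel_exists X Y (g : {linear X -> Y}) :
  exists K (k : {linear K -> X}),
    injective k /\ forall x, g x = 0 <-> exists y, k y = x.
Proof.
exists (kernel g), val; split=> [|x]; first exact: val_inj.
split=> [/eqP gx|[y <-]]; last exact/eqP/(valP y).
by exists (Kernel gx).
Qed.

Lemma short_exact_kernel X M (e : {linear X -> M}) :
  (forall m, exists x, e x = m) ->
  exists K (k : {linear K -> X}), short_exact k e.
Proof. by move=> eS; have [K [k [kI ke]]] := kernel_exists e; exists K, k. Qed.

Lemma short_exact_cokernel K X (k : {linear K -> X}) :
  injective k -> exists C (e : {linear X -> C}), short_exact k e.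
Proof.
move=> kI; exists (cokernel k), (coker k); split=> // [|y];
  first exact: coker_surj.
by rewrite -(linear0 (coker k)) coker_eq subr0.
Qed.
End Exact.

(** * Short exact sequences and vanishing of Ext^1 *)

Section Pairing.
Variables (S : pzRingType) (X Y Z : lmodType S).

Fact pairing_linear (f : {linear X -> Y}) (g : {linear X -> Z}) :
  linear (fun x => (f x, g x) : Y * Z).
Proof. by move=> a u v; rewrite !linearP. Qed.

Definition pairing f g := linear_of (pairing_linear f g).

Lemma pairingE f g x : pairing f g x = (f x, g x).
Proof. by []. Qed.

Fact copairing_linear (f : {linear X -> Z}) (g : {linear Y -> Z}) :
  linear (fun u : X * Y => f u.1 + g u.2).
Proof. by move=> a u v; rewrite !linearP scalerDr addrACA. Qed.

Definition copairing f g := linear_of (copairing_linear f g).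

Lemma copairingE f g u : copairing f g u = f u.1 + g u.2.
Proof. by []. Qed.
End Pairing.

Section Ext1.
Variable S : pzRingType.
Implicit Types (A B K L X Y Z M N P Q G C : lmodType S).

Definition retract_of M G : Prop :=
  exists (i : {linear M -> G}) (r : {linear G -> M}), forall m, r (i m) = m.

Lemma projective_retract M P : retract_of M P -> projective P -> projective M.
Proof.
move=> [i [r ri]] pP X Y g f gS.
have [h hE] := pP X Y g (f \o r) gS.
by exists (h \o i) => m; rewrite /= hE /= ri.
Qed.

Lemma projective_prod P Q :
  projective P -> projective Q -> projective (P * Q)%type.
Proof.
move=> pP pQ X Y g f gS.
have [h1 h1E] := pP X Y g (f \o pairing idfun \0) gS.
have [h2 h2E] := pQ X Y g (f \o pairing \0 idfun) gS.
exists (copairing h1 h2) => -[p q]; rewrite copairingE linearD h1E h2E.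
by rewrite -[_ + _]/(f (p, 0) + f (0, q)) -linearD; congr (f (_, _));
  rewrite /= ?addr0 ?add0r.
Qed.

(** Ext^1(M, Q) = 0, read off the long exact sequences of all short exact
sequences ending in M. Quantifying over all of them, and not only over those
with a projective middle term, lets one restrict and pull back freely. *)
Definition ext1_zero M Q : Prop :=
  forall K X (k : {linear K -> X}) (e : {linear X -> M}), short_exact k e ->
  forall f : {linear K -> Q},
    exists g : {linear X -> Q}, forall x, g (k x) = f x.

Lemma short_exact0 K X M (k : {linear K -> X}) (e : {linear X -> M}) :
  short_exact k e -> forall x, e (k x) = 0.
Proof. by move=> [_ _ ke] x; apply/ke; exists x. Qed.

(** One projective presentation decides Ext^1. Given K' -> X -> M, lift P -> M
to u : P -> X; then X is the quotient of K' * P by K, embedded antidiagonally,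
and a map out of K' * P that kills K is the required extension. *)
Lemma ext1_zero_presentation K P M Q
    (k : {linear K -> P}) (e : {linear P -> M}) :
  projective P -> short_exact k e ->
  (forall f : {linear K -> Q},
     exists g : {linear P -> Q}, forall x, g (k x) = f x) ->
  ext1_zero M Q.
Proof.
move=> pP se kext K' X k' e' se' f.
have [kI eS ke] := se; have [k'I e'S k'e'] := se'.
have [u uE] := pP _ _ e' e e'S.
have [w wE] : exists w : {linear K -> K'}, forall y, k' (w y) = (u \o k) y.
  by apply: factor_inj => // y; apply/k'e'; rewrite /= uE (short_exact0 se).
have [g gE] := kext (f \o w).
have [||h hE] := @factor_surj _ _ _ _ (copairing k' u) (copairing f g).
- move=> x; have [p ep] := eS (e' x).
  have [|a ka] := (k'e' (x - u p)).1; first by rewrite linearB uE ep subrr.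
  by exists (a, p); rewrite copairingE /= ka subrK.
- move=> [a p]; rewrite copairingE /= => kau.
  have [y ky] : exists y, k y = p.
    apply/ke; rewrite -uE; move/(congr1 e'): kau.
    by rewrite linear0 linearD (short_exact0 se') add0r.
  have -> : a = - w y.
    apply: k'I; rewrite linearN wE /= ky; apply/eqP.
    by rewrite -addr_eq0 kau.
  by rewrite linearN -ky gE addNr.
- exists h => x; have := hE (x, 0).
  by rewrite copairingE /= !linear0 !addr0.
Qed.

Lemma ext1_zero_projective P Q : projective P -> ext1_zero P Q.
Proof.
move=> pP K X k e ske f; have [kI eS ke] := ske.
have [s sE] := pP _ _ e idfun eS.
have [|t tE] := @factor_inj _ K X X k (idfun \- (s \o e)) kI.
  by move=> x; apply/ke; rewrite linearB /= sE subrr.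
exists (f \o t) => x; congr (f _); apply: kI.
by rewrite tE /= (short_exact0 ske) linear0 subr0.
Qed.

(** When Z is an extension of B by A, a short exact sequence ending in Z can be
analysed in two steps through the preimage Y of A: this is how vanishing
statements for A and B are combined into one for Z. *)
Lemma short_exact_filter A Z B K X (a : {linear A -> Z}) (b : {linear Z -> B})
    (k : {linear K -> X}) (e : {linear X -> Z}) :
  short_exact a b -> short_exact k e ->
  exists Y (y : {linear Y -> X}) (k1 : {linear K -> Y}) (e1 : {linear Y -> A}),
    [/\ short_exact y (b \o e), short_exact k1 e1 & forall x, y (k1 x) = k x].
Proof.
move=> sab ske; have [aI bS ab] := sab; have [kI eS ke] := ske.
have beS z : exists x, (b \o e) x = z.
  by have [x <-] := bS z; have [x' <-] := eS x; exists x'.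
have [Y [y sy]] := short_exact_kernel beS; have [yI _ yE] := sy.
have [k1 k1E] : exists k1 : {linear K -> Y}, forall x, y (k1 x) = k x.
  by apply: factor_inj => // x; apply/yE; rewrite /= (short_exact0 ske) linear0.
have [e1 e1E] : exists e1 : {linear Y -> A},
    forall x, a (e1 x) = (e \o y) x.
  by apply: factor_inj => // x; apply/ab; apply/yE; exists x.
exists Y, y, k1, e1; split=> //; split=> [u v|z|x].
- by move/(congr1 y); rewrite !k1E => /kI.
- have [x ex] := eS (a z); have [|x' x'E] := (yE x).1.
    by rewrite /= ex (short_exact0 sab).
  by exists x'; apply: aI; rewrite e1E -[LHS]/(e (y x')) x'E.
- split=> [x0|[x' <-]].
    have [|x' kx'] := (ke (y x)).1; first by rewrite -[LHS]e1E x0 linear0.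
    by exists x'; apply: yI; rewrite k1E.
  by apply: aI; rewrite e1E /= k1E (short_exact0 ske) linear0.
Qed.

Lemma ext1_zero_extension A Z B Q (a : {linear A -> Z}) (b : {linear Z -> B}) :
  short_exact a b -> ext1_zero A Q -> ext1_zero B Q -> ext1_zero Z Q.
Proof.
move=> sab eA eB K X k e ske f.
have [Y [y [k1 [e1 [sy sk1 yk1]]]]] := short_exact_filter sab ske.
have [g gE] := eA _ _ _ _ sk1 f; have [h hE] := eB _ _ _ _ sy g.
by exists h => x; rewrite -yk1 hE gE.
Qed.

(** Pull the extension back along the retraction r : G -> M, extend there, and
come back along the section x |-> (x, i (e x)) of the pullback. *)
Lemma ext1_zero_retract M G Q :
  retract_of M G -> ext1_zero G Q -> ext1_zero M Q.
Proof.
move=> [i [r ri]] eG K X k e ske f; have [kI eS ke] := ske.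
pose c : {linear (X * G)%type -> M} := copairing e (r \o -%R).
have [T [t [tI tP]]] := kernel_exists c.
have tc v : e (t v).1 = r (t v).2.
  have : c (t v) = 0 by apply/tP; exists v.
  by rewrite copairingE /= linearN => /eqP; rewrite subr_eq0 => /eqP.
have [k1 k1E] : exists k1 : {linear K -> T},
    forall x, t (k1 x) = (pairing k \0) x.
  apply: factor_inj => // x; apply/tP.
  by rewrite copairingE /= (short_exact0 ske) oppr0 linear0 addr0.
have [s sE] : exists s : {linear X -> T},
    forall x, t (s x) = (pairing idfun (i \o e)) x.
  by apply: factor_inj => // x; apply/tP;
    rewrite copairingE /= linearN ri subrr.
have sk1 : short_exact k1 (snd \o t).
  split=> [u v|g|v].
  - by move/(congr1 t); rewrite !k1E => -[/kI].
  - have [x ex] := eS (r g); have [|v vE] := (tP (x, g)).1.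
      by rewrite copairingE /= linearN ex subrr.
    by exists v; rewrite /= vE.
  - split=> [/= v0|[x <-]]; last by rewrite /= k1E.
    have [|x kx] := (ke (t v).1).1; first by rewrite tc v0 linear0.
    by exists x; apply: tI; rewrite k1E [RHS]surjective_pairing v0 pairingE /=
      kx.
have [h hE] := eG _ _ _ _ sk1 f.
exists (h \o s) => x; rewrite /= -hE; congr (h _); apply: tI.
by rewrite sE k1E pairingE /= (short_exact0 ske) linear0.
Qed.

Definition has_cosyzygy_in (X : lmodType S -> Prop) M : Prop :=
  exists P C (k : {linear M -> P}) (e : {linear P -> C}),
    [/\ projective P, X C & short_exact k e].

Definition has_syzygy_in (X : lmodType S -> Prop) M : Prop :=
  exists P L (k : {linear L -> P}) (e : {linear P -> M}),
    [/\ projective P, X L & short_exact k e].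

(** The self-supporting classes of modules: Gorenstein projectivity is the
largest of them, as [gproj_class_gorenstein_projective] and
[gorenstein_projective_of_class] show. *)
Definition gproj_class (X : lmodType S -> Prop) : Prop :=
  forall M, X M ->
  [/\ has_cosyzygy_in X M, has_syzygy_in X M
    & forall Q, projective Q -> ext1_zero M Q].
End Ext1.

(** * A coinductive form of Gorenstein projectivity *)

Section GorensteinClass.
Variable S : pzRingType.
Implicit Types (A B K L X Y Z M N P Q G C : lmodType S).

Definition cycle_module (P : complex S) Z : Prop :=
  exists i (k : {linear Z -> P (i + 1)}),
    injective k /\ forall x, cdiff P i x = 0 <-> exists z, k z = x.

Lemma cycle_syzygy (P : complex S) i Z (k : {linear Z -> P (i + 1)}) :
  acyclic P -> injective k ->
  (forall x, cdiff P i x = 0 <-> exists z, k z = x) ->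
  exists e : {linear P (i + 1 + 1) -> Z},
   [/\ forall z, exists x, e x = z & forall x, k (e x) = cdiff P (i + 1) x].
Proof.
move=> acP kI kP.
have [|e eE] := factor_inj (f := cdiff P (i + 1)) kI.
  by move=> y; apply/kP; rewrite cdiffK.
exists e; split=> // z; have [|x xE] := acP i (k z); first by apply/kP;
  exists z.
by exists x; apply: kI; rewrite eE.
Qed.

(** Ext^1 of a cycle module vanishes because its syzygy embeds in the next term
of the complex, where acyclicity of Hom(P, Q) extends maps. *)
Lemma gproj_class_cycles (P : complex S) :
  totally_acyclic P -> gproj_class (cycle_module P).
Proof.
move=> [pP acP hP] Z [i [k [kI kP]]].
have [e [eS eE]] := cycle_syzygy acP kI kP.
have [L [l [lI lP]]] := kernel_exists (cdiff P (i + 1)).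
have se : short_exact l e.
  split=> // x; rewrite -lP -eE; split=> [->|/eqP]; first by rewrite linear0.
  by rewrite -[0](linear0 k) => /eqP /kI.
split.
- (* Shifting the index avoids comparing P (i - 1 + 1) with P i. *)
  have [j ij] : exists j, i = j + 1 by exists (i - 1); rewrite subrK.
  subst i; have [C [c [cI cP]]] := kernel_exists (cdiff P j).
  have [e' [e'S e'E]] := cycle_syzygy acP cI cP.
  exists (P (j + 1 + 1)), C, k, e'; split;
    [exact: pP | by exists j, c | split=> // x].
  rewrite -kP -e'E; split=> [->|/eqP]; first by rewrite linear0.
  by rewrite -[0](linear0 c) => /eqP /cI.
- by exists (P (i + 1 + 1)), L, l, e; split; [exact: pP | exists (i + 1), l | ].
- move=> Q pQ; apply: (ext1_zero_presentation (pP _) se) => f.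
  have [_ _ lE] := se.
  have [|d dE] := factor_inj (f := cdiff P (i + 1 + 1)) lI.
    by move=> y; apply/lP; rewrite cdiffK.
  have [y|g gE] := hP Q pQ (i + 1 + 1) (f \o d).
    rewrite /=; suff -> : d (cdiff P (i + 1 + 1 + 1) y) = 0 by rewrite linear0.
    by apply: lI; rewrite dE cdiffK linear0.
  exists g => x; have [|y yE] := acP (i + 1) (l x); first by apply/lP; exists x.
  by rewrite -yE gE /=; congr (f _); apply: lI; rewrite dE.
Qed.

(** Dependent choice in both directions at once. The link at j joins it to j - 1
and not to j + 1, matching a short exact sequence whose middle term has the
index of its left term. *)
Lemma int_chain (T : Type) (r : T -> T -> Prop) (t : T) :
  (forall x, exists y, r x y) -> (forall x, exists y, r y x) ->
  exists z : int -> T, z 0 = t /\ forall j, r (z j) (z (j - 1)).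
Proof.
move=> /choice[f fE] /choice[g gE].
exists (fun j =>
  match j with Posz n => iter n g t | Negz n => iter n.+1 f t end).
split=> // -[[|n]|n]; first exact: fE.
  by rewrite intS addrC addKr; apply: gE.
have -> : Negz n - 1 = Negz n.+1 by rewrite -[LHS]/(Negz (n + 0).+1) addn0.
exact: fE.
Qed.

Definition has_short_exact_proj L M : Prop :=
  exists P (k : {linear L -> P}) (e : {linear P -> M}),
    projective P /\ short_exact k e.

(** Splice syzygies to the left and cosyzygies to the right of M. Each cycle of
the resulting complex is in X; this gives exactness by construction, and
exactness of Hom(-, Q) because Ext^1 of the cycles vanishes. *)
Lemma gorenstein_projective_of_class (X : lmodType S -> Prop) M :
  gproj_class X -> X M -> gorenstein_projective M.
Proof.
move=> Xcl XM.
pose T := {Z : lmodType S | X Z}.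
pose r (y z : T) := has_short_exact_proj (sval y) (sval z).
have [z [z0 zr]] : exists z : int -> T,
    z 0 = exist _ M XM /\ forall j, r (z j) (z (j - 1)).
  apply: int_chain => -[Z XZ].
  - have [[P [C [k [e [pP XC se]]]]] _ _] := Xcl _ XZ.
    by exists (exist _ C XC), P, k, e.
  - have [_ [P [L [k [e [pP XL se]]]]] _] := Xcl _ XZ.
    by exists (exist _ L XL), P, k, e.
pose Z j := sval (z j).
pose P j := sval (cid (zr j)).
pose k j : {linear Z j -> P j} := sval (cid (svalP (cid (zr j)))).
have [e eE] : exists e : forall i, {linear P (i + 1) -> Z i},
   forall i, projective (P (i + 1)) /\ short_exact (k (i + 1)) (e i).
  (* The short exact sequence at j ends in Z (j - 1); for j = i + 1 this is Z i
     only up to a proof, so the index is generalized before rewriting. *)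
  have eP i j : j = i + 1 ->
      exists e : {linear P j -> Z i}, projective (P j) /\ short_exact (k j) e.
    move=> ji; have -> : i = j - 1 by rewrite ji addrK.
    exact: (svalP (cid (svalP (cid (zr j))))).
  by exists (fun i => sval (cid (eP i _ erefl))) => i;
    apply: (svalP (cid (eP i _ erefl))).
have kI j : injective (k j).
  by rewrite -[j](subrK 1); have [_ []] := eE (j - 1).
have ke i x : k i (e i x) = 0 <-> e i x = 0.
  by split=> [/eqP|->]; rewrite ?linear0 // -[0](linear0 (k i)) => /eqP /kI.
have dK i x : (k i \o e i) ((k (i + 1) \o e (i + 1)) x) = 0.
  by have [_ se] := eE i; rewrite /= (short_exact0 se) linear0.
exists (Complex dK).
have k0 (t : T) : z 0 = t -> exists k0 : {linear sval t -> P 0},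
    injective k0 /\ forall x : P 0, (e (-1) x = 0 <-> exists m, k0 m = x).
  by move=> <-; exists (k 0); have [_ []] := eE (-1).
have [k0' [k0I k0P]] := k0 _ z0; exists k0'; split=> // [|x];
  last by rewrite -k0P -ke.
split=> [i|i x|Q pQ i f fd0] /=.
- by rewrite -[i](subrK 1); have [] := eE (i - 1).
- move=> /ke; have [_ [_ _ seE]] := eE i; move=> /seE[y <-].
  by have [_ [_ /(_ y)[u <-] _]] := eE (i + 1); exists u.
- have [_ se] := eE i; have [_ eS seE] := se.
  have [|g gE] := factor_surj (f := f) eS.
    move=> x /seE[y <-]; have [_ [_ /(_ y)[u <-] _]] := eE (i + 1).
    exact: fd0.
  have [_ se'] := eE (i - 1).
  have [_ _ X1] := Xcl _ (svalP (z (i - 1))).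
  (* Here again i and i - 1 + 1 are identified while the index is a variable. *)
  have hE j : j = i - 1 + 1 -> forall g : {linear Z j -> Q},
      exists h : {linear P j -> Q}, forall x, h (k j x) = g x.
    by move=> -> g'; apply: X1 se' g'.
  have [h hkE] := hE i (esym (subrK 1 i)) g.
  by exists h => x; rewrite hkE gE.
Qed.

Lemma gproj_class_gorenstein_projective :
  gproj_class (@gorenstein_projective S).
Proof.
move=> M [P [k [taP kI kP]]].
have cl := gproj_class_cycles taP.
have cyc Z : cycle_module P Z -> gorenstein_projective Z.
  by apply: gorenstein_projective_of_class.
have [|[P1 [C [k1 [e1 [pP1 XC se1]]]]] [P2 [L [k2 [e2 [pP2 XL se2]]]]] eM] :=
  cl M.
  by exists (-1), k.
split=> //; first by exists P1, C, k1, e1; split=> //; apply: cyc.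
by exists P2, L, k2, e2; split=> //; apply: cyc.
Qed.

End GorensteinClass.

(** * Products and retracts *)

Section Retracts.
Variable S : pzRingType.
Implicit Types (A B K L X Y Z M N P Q G C : lmodType S).

Lemma gorenstein_projective_ext1 M Q :
  gorenstein_projective M -> projective Q -> ext1_zero M Q.
Proof. by move=> /gproj_class_gorenstein_projective[_ _]; apply. Qed.

(** Membership up to one step: adjoining M to the class of Gorenstein
projectives keeps the class self-supporting. *)
Lemma gorenstein_projective_step M :
  has_cosyzygy_in (@gorenstein_projective S) M ->
  has_syzygy_in (@gorenstein_projective S) M ->
  (forall Q, projective Q -> ext1_zero M Q) -> gorenstein_projective M.
Proof.
move=> [P [C [k [e [pP gC se]]]]] [P' [L [k' [e' [pP' gL se']]]]] eM.
pose X Z := gorenstein_projective Z \/ Z = M.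
apply: (@gorenstein_projective_of_class _ X); last by right.
move=> Z [/gproj_class_gorenstein_projective|->].
  move=> [[P1 [C1 [k1 [e1 [? ? ?]]]]] [P2 [L2 [k2 [e2 [? ? ?]]]]] ?];
    split=> //.
    by exists P1, C1, k1, e1; split=> //; left.
  by exists P2, L2, k2, e2; split=> //; left.
split=> //; first by exists P, C, k, e; split=> //; left.
by exists P', L, k', e'; split=> //; left.
Qed.

Lemma short_exact_prod N K :
  short_exact (pairing idfun \0 : {linear N -> (N * K)%type})
    (snd : {linear (N * K)%type -> K}).
Proof.
split=> [x y [] //|y|[x y] /=]; first by exists (0, y).
by split=> [->|[z [_ <-]] //]; exists x.
Qed.

Lemma ext1_zero_prod N K Q :
  ext1_zero N Q -> projective K -> ext1_zero (N * K)%type Q.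
Proof.
move=> eN pK; apply: (ext1_zero_extension (short_exact_prod N K)) => //.
exact: ext1_zero_projective.
Qed.

Lemma gorenstein_projective_prod N K :
  gorenstein_projective N -> projective K -> gorenstein_projective (N * K)%type.
Proof.
move=> gN pK.
have [[P [C [k [e [pP gC [kI eS ke]]]]]]
    [P' [L [l [f [pP' gL [lI fS lf]]]]]] eN] :=
  gproj_class_gorenstein_projective gN.
apply: gorenstein_projective_step => [||Q pQ].
- exists (P * K)%type, C, (pairing (k \o fst) snd), (e \o fst).
  split=> //; first exact: projective_prod.
  split=> [[x a] [y b] [/kI -> ->] //|c|[p a] /=].
    by have [p <-] := eS c; exists (p, 0).
  rewrite ke; split=> [[x <-]|[[x b] [<- _]]]; last by exists x.
  by exists (x, a).
- exists (P' * K)%type, L, (pairing l \0), (pairing (f \o fst) snd).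
  split=> //; first exact: projective_prod.
  split=> [x y [/lI] //|[x a]|[p a]].
    by have [p <-] := fS x; exists (p, a).
  split=> [[/= /lf[x <-] ->]|[x [<- <-]]]; first by exists x.
  by rewrite pairingE /= (iffRL (lf _)) //; exists x.
- exact: ext1_zero_prod (eN _ pQ) pK.
Qed.

(** The comparison maps u and v make p |-> ([u p], p - v (u p)) pass to the
quotient C, and ([p], p') |-> [v p] + [p'] retracts it. When M = G this is the
dual of Schanuel's lemma; there u and v would come from Ext^1 vanishing, but u
may also be given directly, as in [res_gproj_cosyzygy]. *)
Lemma retract_cosyzygy M G P P' N C (i : {linear M -> G}) (r : {linear G -> M})
    (k : {linear G -> P}) (q : {linear P -> N})
    (j : {linear M -> P'}) (c : {linear P' -> C})
    (u : {linear P' -> P}) (v : {linear P -> P'}) :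
  (forall m, r (i m) = m) -> short_exact k q -> short_exact j c ->
  (forall m, u (j m) = k (i m)) -> (forall g, v (k g) = j (r g)) ->
  retract_of C (N * P')%type.
Proof.
move=> ri skq sjc uE vE; have [_ qS qE] := skq; have [_ cS cE] := sjc.
have [|a aE] := factor_surj (f := pairing (q \o u) (idfun \- (v \o u))) cS.
  move=> _ /cE[m <-].
  by rewrite pairingE /= uE vE ri subrr (short_exact0 skq).
have [|b bE] := factor_surj (f := c \o v) qS.
  by move=> _ /qE[g <-]; rewrite /= vE (short_exact0 sjc).
exists a, (copairing b c) => z; have [p <-] := cS z.
by rewrite aE copairingE /= bE /= linearB addrC subrK.
Qed.

(** The comparison maps u : P -> P' and v : P' -> P exist by projectivity;
x |-> (v x, x) embeds L', and (l, p') |-> u l + p' - u (v p') retracts it. *)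
Lemma retract_syzygy M G P P' L L' (i : {linear M -> G}) (r : {linear G -> M})
    (k : {linear L -> P}) (q : {linear P -> G})
    (j : {linear L' -> P'}) (c : {linear P' -> M}) :
  (forall m, r (i m) = m) -> short_exact k q -> short_exact j c ->
  projective P -> projective P' -> retract_of L' (L * P')%type.
Proof.
move=> ri skq sjc pP pP'; have [kI qS qE] := skq; have [jI cS cE] := sjc.
have [u uE] := pP _ _ c (r \o q) cS; have [v vE] := pP' _ _ q (i \o c) qS.
have [|a aE] := factor_inj (f := v \o j) kI.
  by move=> y; apply/qE; rewrite /= vE /= (short_exact0 sjc) linear0.
have [|b bE] := factor_inj (f := copairing (u \o k) (idfun \- (u \o v))) jI.
  move=> y; apply/cE; rewrite copairingE linearD linearB /= !uE /= vE /= ri.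
  by rewrite (short_exact0 skq) linear0 subrr addr0.
exists (pairing a j), b => x; apply: jI.
by rewrite bE copairingE pairingE /= aE /= addrC subrK.
Qed.

(** The retracts of Gorenstein projectives form a self-supporting class, by
[retract_cosyzygy] and [retract_syzygy]. *)
Lemma gorenstein_projective_retract M G :
  retract_of M G -> gorenstein_projective G -> gorenstein_projective M.
Proof.
move=> rMG gG.
apply: (@gorenstein_projective_of_class _
  (fun Z => exists2 G' : lmodType S,
    retract_of Z G' & gorenstein_projective G'));
  last by exists G.
move=> {M G rMG gG} M [G rMG gG]; have [i [r ri]] := rMG.
have [[P [N [k [q [pP gN skq]]]]] [P' [L [l [f [pP' gL slf]]]]] eG] :=
  gproj_class_gorenstein_projective gG.
have [kI _ _] := skq; have [_ fS _] := slf.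
split=> [||Q pQ].
- have [|C [c sc]] := @short_exact_cokernel _ _ _ (k \o i).
    by move=> x y /kI /(congr1 r); rewrite !ri.
  have [v vE] := gorenstein_projective_ext1 gN pP skq (k \o i \o r).
  have rC := retract_cosyzygy ri skq sc (u := idfun) (fun=> erefl) vE.
  exists P, C, (k \o i), c; split=> //; exists (N * P)%type => //.
  exact: gorenstein_projective_prod.
- have [|L' [j sj]] := @short_exact_kernel _ _ _ (r \o f).
    by move=> m; have [p pE] := fS (i m); exists p; rewrite /= pE ri.
  exists P', L', j, (r \o f); split=> //; exists (L * P')%type.
    exact: (retract_syzygy ri slf sj).
  exact: gorenstein_projective_prod.
- exact/(ext1_zero_retract rMG)/eG.
Qed.

End Retracts.

(** * Higher Ext and Gorenstein projective dimension *)

Section GorensteinDimension.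
Variable S : pzRingType.
Implicit Types (A B K L X Y Z M N P Q G C : lmodType S).

(** [ext_zero n M Q] stands for Ext^(n+1)(M, Q) = 0, by dimension shifting.
Asking for all syzygies makes the comparison of two presentations part of the
definition: no independence of the choice is to be proved. *)
Fixpoint ext_zero (n : nat) M Q : Prop :=
  if n is m.+1 then
    forall P K (k : {linear K -> P}) (e : {linear P -> M}),
      projective P -> short_exact k e -> ext_zero m K Q
  else ext1_zero M Q.

(** A presentation of K * P restricts to one of K, since the preimage of K in
the middle term is the kernel of a surjection onto P, hence a direct summand. *)
Lemma ext_zero_prod n K P Q :
  projective P -> ext_zero n K Q -> ext_zero n (K * P)%type Q.
Proof.
move=> pP; case: n => [|n] eK; first exact: ext1_zero_prod.
move=> X L k e pX se.
have [Y [y [k1 [e1 [sy sk1 _]]]]] :=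
  short_exact_filter (short_exact_prod K P) se.
apply: eK sk1; apply: projective_retract pX.
have [r rE] := ext1_zero_projective pP sy idfun.
by exists y, r.
Qed.

(** Cover Z by X * P, where X covers K and P covers G: the kernel T of X * P ->
Z is an extension of the kernel of P -> G by the kernel of X -> K. *)
Lemma short_exact_syzygy K Z G M X L P
    (a : {linear K -> Z}) (b : {linear Z -> G})
    (m : {linear M -> X}) (c : {linear X -> K})
    (l : {linear L -> P}) (e : {linear P -> G}) :
  short_exact a b -> short_exact m c -> short_exact l e -> projective P ->
  exists (T : lmodType S)
      (t : {linear T -> (X * P)%type}) (d : {linear (X * P)%type -> Z})
      (m1 : {linear M -> T}) (c1 : {linear T -> L}),
    [/\ short_exact t d, short_exact m1 c1 & forall x, t (m1 x) = (m x, 0)].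
Proof.
move=> sab smc sle pP.
have [aI bS aE] := sab; have [mI cS mE] := smc; have [lI eS lE] := sle.
have [u uE] := pP _ _ b e bS.
pose d := copairing (a \o c) u.
have [|T [t st]] := @short_exact_kernel _ _ _ d.
  move=> z; have [p ep] := eS (b z).
  have [|x xE] := (aE (z - u p)).1; first by rewrite linearB uE ep subrr.
  have [x' x'E] := cS x; exists (x', p).
  by rewrite copairingE /= x'E xE subrK.
have [tI _ tE] := st.
have [|m1 m1E] := factor_inj (f := pairing m \0) tI.
  by move=> x; apply/tE; rewrite copairingE /= (short_exact0 smc) !linear0
    addr0.
have [|c1 c1E] := factor_inj (f := snd \o t) lI.
  move=> x; apply/lE; have /tE : exists y, t y = t x by exists x.
  rewrite copairingE /= => /(congr1 b).
  by rewrite linearD (short_exact0 sab) add0r uE linear0.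
exists T, t, d, m1, c1; split=> //; split=> [x y|y|x].
- by move/(congr1 t); rewrite !m1E => -[/mI].
- have [|x xE] := (aE (u (l y))).1; first by rewrite uE (short_exact0 sle).
  have [x' x'E] := cS x.
  have [|v vE] := (tE (- x', l y)).1.
    by rewrite copairingE /= !linearN x'E xE addNr.
  by exists v; apply: lI; rewrite c1E /= vE.
- split=> [x0|[y <-]]; last by apply: lI; rewrite c1E /= m1E linear0.
  have t2 : (t x).2 = 0 by rewrite -[LHS](c1E x) x0 linear0.
  have /tE : exists y, t y = t x by exists x.
  rewrite copairingE t2 linear0 addr0 /= -[0](linear0 a) => /aI /mE[y yE].
  by exists y; apply: tI; rewrite m1E pairingE /= yE [RHS]surjective_pairing t2.
Qed.

(** In the long exact sequence, Ext^(n+1)(K, Q) sits between Ext^(n+1)(Z, Q) and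
Ext^(n+2)(G, Q), and the latter is zero. The induction replaces K, Z, G by their
syzygies. *)
Lemma ext_zero_kernel n K Z G Q (a : {linear K -> Z}) (b : {linear Z -> G}) :
  short_exact a b -> gorenstein_projective G -> projective Q ->
  ext_zero n Z Q -> ext_zero n K Q.
Proof.
elim: n K Z G a b => [|n IH] K Z G a b sab gG pQ.
all: have [_ [P [L [l [e [pP gL sle]]]]] _] :=
  gproj_class_gorenstein_projective gG.
- move=> eZ M X m c smc f.
  have [T [t [d [m1 [c1 [st sm1 tm1]]]]]] := short_exact_syzygy sab smc sle pP.
  have [g gE] := gorenstein_projective_ext1 gL pQ sm1 f.
  have [h hE] := eZ _ _ _ _ st g.
  by exists (h \o pairing idfun \0) => x; rewrite -gE -hE tm1.
- move=> eZ X M m c pX smc.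
  have [T [t [d [m1 [c1 [st sm1 _]]]]]] := short_exact_syzygy sab smc sle pP.
  by apply: IH sm1 gL pQ _; apply: eZ st; apply: projective_prod.
Qed.

(** Let K' be the kernel of G 0 -> M. Any syzygy K -> P -> M fits in a short
exact sequence K -> K' * P -> G 0, which transfers the vanishing for K' to K. *)
Lemma gproj_resolution_ext_zero n M Q :
  projective Q -> gproj_resolution M n -> ext_zero n M Q.
Proof.
move=> pQ; elim: n M => [|n IH] M [G [d [e [gG G0 eS eE dE]]]].
  have eI : injective e.
    move=> x y /eqP; rewrite -subr_eq0 -linearB => /eqP /eE[z].
    by rewrite (G0 1%N isT z) linear0 => /esym /eqP; rewrite subr_eq0 => /eqP.
  apply: ext1_zero_retract (gorenstein_projective_ext1 (gG 0%N isT) pQ).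
  have [|i iE] := factor_inj (f := idfun) eI; first exact: eS.
  by exists i, e.
have [K' [a sae]] := short_exact_kernel eS; have [aI _ aE] := sae.
have [|e' e'E] := factor_inj (f := d 0%N) aI.
  by move=> y; apply/aE/eE; exists y.
have eK' : ext_zero n K' Q.
  apply: IH; exists (fun i => G i.+1), (fun i => d i.+1), e'.
  split=> [i lin|i lni x|z|x|i x]; [exact: gG | exact: G0 | | | exact: dE].
    have /eE[x xE] : e (a z) = 0 by rewrite (short_exact0 sae).
    by exists x; apply: aI; rewrite e'E.
  rewrite -dE -e'E; split=> [->|/eqP]; first by rewrite linear0.
  by rewrite -[0](linear0 a) => /eqP /aI.
move=> P K k p pP skp; have [kI pS pE] := skp.
have [v vE] := pP _ _ e p eS.
have [|w wE] := factor_inj (f := v \o k) aI.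
  by move=> x; apply/aE; rewrite /= vE (short_exact0 skp).
apply: (@ext_zero_kernel n K (K' * P)%type (G 0%N) Q (pairing w k)
  (copairing a (v \o -%R))) (gG 0%N isT) pQ (ext_zero_prod pP eK').
split=> [x y [_ /kI] //|g|[x y]].
- have [y yE] := pS (- e g).
  have [|x xE] := (aE (g + v y)).1; first by rewrite linearD vE yE subrr.
  by exists (x, y); rewrite copairingE /= linearN xE addrK.
- rewrite copairingE /= linearN; split=> [/eqP|[z [<- <-]]].
    rewrite subr_eq0 => /eqP axy.
    have [|z zE] := (pE y).1; first by rewrite -vE -axy (short_exact0 sae).
    by exists z; rewrite -[LHS]/(w z, k z) zE; congr (_, _); apply: aI;
      rewrite wE /= zE axy.
  by rewrite wE /= subrr.
Qed.

(** Needed to lengthen a resolution by zero modules. *)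
Lemma gorenstein_projective_zero M :
  (forall x : M, x = 0) -> gorenstein_projective M.
Proof.
move=> M0.
have pM : projective M.
  by move=> X Y g f gS; exists \0 => p; rewrite (M0 p) !linear0.
apply: (@gorenstein_projective_of_class _ (eq^~ M)) => // _ ->.
have se : short_exact (idfun : {linear M -> M}) (idfun : {linear M -> M}).
  by split=> [x y _|m|x] //; [exists m | split=> _ //; exists x].
by split; [exists M, M, idfun, idfun | exists M, M, idfun, idfun |
  move=> Q _; apply: ext1_zero_projective].
Qed.

Lemma gproj_resolution_widen n m M :
  (n <= m)%N -> gproj_resolution M n -> gproj_resolution M m.
Proof.
move=> nm [G [d [e [gG G0 eS eE dE]]]]; exists G, d, e; split=> // i im.
  have [/gG //|/G0 Gi] := leqP i n; exact: gorenstein_projective_zero.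
exact/G0/(leq_ltn_trans nm).
Qed.

(** Ext^1(M, Q) = Ext^(n+1)(C, Q) for an n-th cosyzygy C of M. *)
Lemma ext1_zero_cosyzygy (X : lmodType S -> Prop) n M Q :
  (forall Z, X Z -> has_cosyzygy_in X Z) ->
  (forall Z, ext_zero n Z Q) -> X M -> ext1_zero M Q.
Proof.
move=> Xco eX XM.
suff {M XM} e0 j : (j <= n)%N -> forall Z, X Z -> ext_zero (n - j) Z Q.
  by have := e0 n (leqnn n) M XM; rewrite subnn.
elim: j => [|j IH] jn Z XZ; first by rewrite subn0.
have [P [C [k [e [pP XC se]]]]] := Xco Z XZ.
by have := IH (ltnW jn) C XC; rewrite -subnSK //= => /(_ P Z k e); apply.
Qed.

End GorensteinDimension.

(** * Restriction and coinduction *)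

Section Coinduction.
Variables (R A : pzRingType) (iota : {rmorphism R -> A}) (Q : lmodType R).

Definition coind_pred : {pred A -> Q} := fun phi =>
  `[< (forall a b, phi (a + b) = phi a + phi b) /\
      (forall r a, phi (iota r * a) = r *: phi a) >].

Fact coind_zmod_closed : zmod_closed coind_pred.
Proof.
split=> [|f g /asboolP[fD fZ] /asboolP[gD gZ]]; apply/asboolP; split.
- by move=> a b; rewrite /= addr0.
- by move=> r a; rewrite /= scaler0.
- by move=> a b; rewrite !fctE fD gD opprD addrACA.
- by move=> r a; rewrite !fctE fZ gZ scalerBr.
Qed.

HB.instance Definition _ :=
  GRing.isZmodClosed.Build (A -> Q) coind_pred coind_zmod_closed.

Record coind := Coind { coind_fun :> A -> Q; _ : coind_fun \in coind_pred }.

HB.instance Definition _ := [isSub for coind_fun].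
HB.instance Definition _ := [Choice of coind by <:].
HB.instance Definition _ := [SubChoice_isSubZmodule of coind by <:].

Lemma coindP (phi psi : coind) : phi =1 psi -> phi = psi.
Proof. by move=> h; apply/val_inj/funext. Qed.

Lemma coindD (phi : coind) a b : phi (a + b) = phi a + phi b.
Proof. by have /asboolP[] := valP phi. Qed.

Lemma coindZ (phi : coind) r a : phi (iota r * a) = r *: phi a.
Proof. by have /asboolP[] := valP phi. Qed.

Lemma coind_sum (phi : coind) n (F : 'I_n -> A) :
  phi (\sum_i F i) = \sum_i phi (F i).
Proof.
apply: (big_morph phi (coindD phi)).
by apply: (addrI (phi 0)); rewrite -coindD !addr0.
Qed.

Lemma coind_addE (phi psi : coind) a : (phi + psi) a = phi a + psi a.
Proof. by []. Qed.

Fact coind_scale_subproof (a : A) (phi : coind) :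
  (fun b => phi (b * a)) \in coind_pred.
Proof.
by apply/asboolP; split=> *; rewrite ?mulrDl ?coindD // -mulrA coindZ.
Qed.

(** A acts on Hom_R(A, Q) through right multiplication on the source. *)
Definition coind_scale a phi := Coind (coind_scale_subproof a phi).

Fact coind_scaleA a b phi :
  coind_scale a (coind_scale b phi) = coind_scale (a * b) phi.
Proof. by apply: coindP => c /=; rewrite mulrA. Qed.

Fact coind_scale1 : left_id 1 coind_scale.
Proof. by move=> phi; apply: coindP => c /=; rewrite mulr1. Qed.

Fact coind_scaleDr : right_distributive coind_scale +%R.
Proof. by move=> a phi psi; apply: coindP. Qed.

Fact coind_scaleDl phi : {morph coind_scale^~ phi : a b / a + b}.
Proof.
move=> a b; apply: coindP => c.
by rewrite -[RHS]/(phi (c * a) + phi (c * b)) /= mulrDr coindD.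
Qed.

HB.instance Definition _ := GRing.Zmodule_isLmodule.Build A coind
  coind_scaleA coind_scale1 coind_scaleDr coind_scaleDl.

Lemma coind_scaleE a (phi : coind) b : (a *: phi) b = phi (b * a).
Proof. by []. Qed.

Fact coind_ev_linear :
  linear (fun phi : restrict_scalars iota coind => (phi : coind) 1).
Proof.
move=> r phi psi; rewrite [in LHS]/( *:%R) /=.
by rewrite -[LHS]/(phi (1 * iota r) + psi 1) mul1r -[iota r]mulr1 coindZ.
Qed.

Definition coind_ev := linear_of coind_ev_linear.

Section CoindAdj.
Variables (X : lmodType A) (g : {linear restrict_scalars iota X -> Q}).

Fact coind_adj_subproof (x : X) : (fun a => g (a *: x)) \in coind_pred.
Proof.
apply/asboolP; split=> [a b|r a]; first by rewrite scalerDl linearD.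
by rewrite -scalerA -[LHS]/(g (r *: (a *: x : restrict_scalars iota X)))
  linearZ_LR.
Qed.

Fact coind_adj_linear : linear (fun x => Coind (coind_adj_subproof x)).
Proof.
move=> a u v; apply: coindP => b.
by rewrite coind_addE coind_scaleE /= scalerDr scalerA linearD.
Qed.

(** The adjunction Hom_R(Res X, Q) = Hom_A(X, Hom_R(A, Q)), with counit
[coind_ev]. *)
Definition coind_adj : {linear X -> coind} := linear_of coind_adj_linear.

Lemma coind_adjE x a : coind_adj x a = g (a *: x).
Proof. by []. Qed.

Lemma coind_adj1 x : coind_adj x 1 = g x.
Proof. by rewrite coind_adjE scale1r. Qed.
End CoindAdj.
End Coinduction.

Section Restriction.
Variables (R A : pzRingType) (iota : {rmorphism R -> A}).
Local Notation Res := (restrict_scalars iota).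

Fact res_map_linear (X Y : lmodType A) (f : {linear X -> Y}) :
  linear (f : Res X -> Res Y).
Proof. by move=> r u v; exact: (linearP f). Qed.

Definition res_map (X Y : lmodType A) (f : {linear X -> Y}) :
    {linear Res X -> Res Y} :=
  linear_of (res_map_linear f).

Lemma short_exact_res (K X M : lmodType A)
    (k : {linear K -> X}) (e : {linear X -> M}) :
  short_exact k e -> short_exact (res_map k) (res_map e).
Proof. by []. Qed.
End Restriction.

(** * Frobenius extensions *)

Section Frobenius.
Variables (R A : pzRingType) (iota : {rmorphism R -> A}).
Local Notation Res := (restrict_scalars iota).
Hypothesis frob : frobenius_extension iota.

(** Coinduction is exact because A is a finitely generated projective R-module:
the second dual basis identity rebuilds a map out of A from finitely many
values. *)
Lemma coind_surj (X Y : lmodType R) (f : {linear X -> Y}) :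
  (forall y, exists x, f x = y) ->
  forall psi : coind iota Y, exists phi : coind iota X, forall a,
    f (phi a) = psi a.
Proof.
have [tau [n [x [y [tauL tauR xy yx]]]]] := frob.
move=> fS psi; have [s sE] := choice fS.
have phiP : (fun a => \sum_i tau (a * x i) *: s (psi (y i)))
    \in coind_pred iota (Q := X).
  apply/asboolP; split=> [a b|r a].
    by rewrite -big_split; apply: eq_bigr => i _;
      rewrite mulrDl raddfD scalerDl.
  rewrite scaler_sumr; apply: eq_bigr => i _.
  by rewrite -mulrA tauL scalerA.
exists (Coind phiP) => a /=; rewrite linear_sum -[in RHS](yx a) coind_sum.
by apply: eq_bigr => i _; rewrite linearZ_LR sE coindZ.
Qed.

(** Hom_R(A, Q) is induced from Q: the unit sends q to a |-> tau a *: q, and a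
map f corresponds to phi |-> \sum_i x i *: f (phi (y i)). The latter is A-linear
since the sum of the tensors of x i and y i commutes with A. *)
Lemma coind_universal (Q : lmodType R) :
  exists eta : {linear Q -> Res (coind iota Q)}, forall X : lmodType A,
    (forall f : {linear Q -> Res X},
       exists g : {linear coind iota Q -> X}, forall q, g (eta q) = f q) /\
    (forall g g' : {linear coind iota Q -> X},
       (forall q, g (eta q) = g' (eta q)) -> g =1 g').
Proof.
have [tau [n [x [y [tauL tauR xy yx]]]]] := frob.
have etaP q : (fun a => tau a *: q) \in coind_pred iota (Q := Q).
  by apply/asboolP; split=> *; rewrite ?raddfD ?scalerDl // tauL scalerA.
have etaL : linear (fun q => Coind (etaP q) : Res (coind iota Q)).
  move=> r u v; apply: coindP => a.
  rewrite -[RHS]/(tau (a * iota r) *: u + tau a *: v) tauR /=.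
  by rewrite scalerDr scalerA.
exists (linear_of etaL) => X; split=> [f|g g' gg' phi].
  have gL : linear
      (fun phi : coind iota Q => \sum_i x i *: (f (phi (y i)) : X)).
    move=> b phi psi.
    have -> : b *: (\sum_i x i *: (f (phi (y i)) : X)) =
        \sum_i x i *: (f (phi (y i * b)) : X).
      under [RHS]eq_bigr => i _.
        rewrite -(yx (y i * b)) coind_sum linear_sum scaler_sumr.
        under eq_bigr => j _ do rewrite coindZ linearZ_LR scalerA.
      over.
      rewrite exchange_big scaler_sumr; apply: eq_bigr => j _ /=.
      rewrite -scaler_suml scalerA -[in LHS](xy (b * x j)).
      by under eq_bigr => i _ do rewrite mulrA.
    rewrite -big_split; apply: eq_bigr => i _ /=.
    by rewrite -[LHS]/(x i *: (f (phi (y i * b) + psi (y i)) : X)) linearD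
      scalerDr.
  exists (linear_of gL) => q /=.
  rewrite -[RHS](scale1r (f q : X)) -[in RHS](xy 1) scaler_suml;
    apply: eq_bigr => i _.
  by rewrite mulr1 linearZ_LR -scalerA.
have -> : phi = \sum_i x i *: (linear_of etaL (phi (y i)) : coind iota Q).
  apply: coindP => a; rewrite -[in LHS](yx a) coind_sum.
  have ev : {morph (fun psi : coind iota Q => psi a) : u v / u + v >-> u + v}.
    by [].
  rewrite (big_morph _ ev (erefl : (0 : coind iota Q) a = 0)).
  by apply: eq_bigr => i _; rewrite coindZ.
by rewrite !linear_sum; apply: eq_bigr => i _; rewrite !linearZ_LR gg'.
Qed.

(** The right adjoint of Res preserves surjections. *)
Lemma projective_res (P : lmodType A) : projective P -> projective (Res P).
Proof.
move=> pP X Y g f gS.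
have [psi|H HE] := pP _ _ (coind_adj (g \o coind_ev iota X)) (coind_adj f).
  have [phi phiE] := coind_surj gS psi; exists phi; apply: coindP => a.
  by rewrite coind_adjE -phiE -[a in RHS]mul1r.
exists (coind_ev iota X \o res_map iota H) => p.
have /(congr1 (fun psi : coind iota Y => psi 1)) := HE p.
by rewrite !coind_adj1.
Qed.

(** The right adjoint of induction, Res, preserves surjections. *)
Lemma projective_coind (Q : lmodType R) :
  projective Q -> projective (coind iota Q).
Proof.
move=> pQ X Y g f gS; have [eta etaU] := coind_universal Q.
have [h hE] := pQ _ _ (res_map iota g) (res_map iota f \o eta) gS.
have [/(_ h)[h' h'E] _] := etaU X; have [_ uniqY] := etaU Y.
by exists h'; apply: (uniqY (g \o h')) => q /=; rewrite h'E; exact: hE.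
Qed.

Section ResComplex.
Variable P : complex A.

Fact res_complex_subproof i (x : Res (P (i + 1 + 1))) :
  res_map iota (cdiff P i) (res_map iota (cdiff P (i + 1)) x) = 0.
Proof. exact: cdiffK. Qed.

Definition res_complex : complex R := Complex res_complex_subproof.
End ResComplex.

Lemma gorenstein_projective_res (M : lmodType A) :
  gorenstein_projective M -> gorenstein_projective (Res M).
Proof.
move=> [P [k [[pP acP hP] kI kE]]].
exists (res_complex P), (res_map iota k); split=> //;
  split=> [i|//|Q pQ i f fd].
  exact/projective_res/pP.
have [y|g gE] := hP _ (projective_coind pQ) i (coind_adj f).
  apply: coindP => a; rewrite coind_adjE -linearZ_LR; exact: fd.
exists (coind_ev iota Q \o res_map iota g) => x.
have /(congr1 (fun psi : coind iota Q => psi 1)) := gE x.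
by rewrite coind_adj1.
Qed.

(** Evaluation at 1 sends the adjoint j of k back to k, so j is injective and
serves as a comparison map in [retract_cosyzygy]; the other comparison map
exists because Ext^1_R(N, -) vanishes on projectives, N being the cokernel of k. *)
Lemma res_gproj_cosyzygy (M : lmodType A) :
  gorenstein_projective (Res M) ->
  has_cosyzygy_in (fun Z => gorenstein_projective (Res Z)) M.
Proof.
move=> gM.
have [[P [N [k [q [pP gN skq]]]]] _ _] := gproj_class_gorenstein_projective gM.
have [kI _ _] := skq; pose j := coind_adj k.
have j1 m : j m 1 = k m by exact: coind_adj1.
have [|C [c sc]] := @short_exact_cokernel _ _ _ j.
  by move=> x y jxy; apply: kI; rewrite -!j1 jxy.
have pI := projective_coind pP.
have [v vE] :=
  gorenstein_projective_ext1 gN (projective_res pI) skq (res_map iota j).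
exists (coind iota P), C, j, c; split=> //.
apply: gorenstein_projective_retract
  (gorenstein_projective_prod gN (projective_res pI)).
exact: (retract_cosyzygy (i := idfun) (r := idfun) (fun=> erefl) skq
  (short_exact_res iota sc) (u := coind_ev iota P) j1 vE).
Qed.

(** A projective presentation of Res M induces a surjection from an induced
module, whose kernel is compared over R with the one given by Res M. *)
Lemma res_gproj_syzygy (M : lmodType A) :
  gorenstein_projective (Res M) ->
  has_syzygy_in (fun Z => gorenstein_projective (Res Z)) M.
Proof.
move=> gM.
have [_ [P [N [k [q [pP gN skq]]]]] _] := gproj_class_gorenstein_projective gM.
have [_ qS _] := skq; have [eta etaU] := coind_universal P.
have [/(_ q)[e eE] _] := etaU M.
have [|L [l sl]] := @short_exact_kernel _ _ _ e.
  by move=> m; have [p <-] := qS m; exists (eta p).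
have pI := projective_coind pP.
exists (coind iota P), L, l, e; split=> //.
apply: gorenstein_projective_retract
  (gorenstein_projective_prod gN (projective_res pI)).
exact: (retract_syzygy (i := idfun) (r := idfun) (fun=> erefl) skq
  (short_exact_res iota sl) pP (projective_res pI)).
Qed.

Lemma gorenstein_projective_of_res :
  (forall M Q : lmodType A, gorenstein_projective (Res M) -> projective Q ->
    ext1_zero M Q) ->
  forall M : lmodType A, gorenstein_projective (Res M) ->
    gorenstein_projective M.
Proof.
move=> ext0 M gM.
apply: (@gorenstein_projective_of_class _
  (fun Z => gorenstein_projective (Res Z))) => //.
by move=> Z gZ; split; [exact: res_gproj_cosyzygy | exact: res_gproj_syzygy |
  move=> Q; apply: ext0].
Qed.

Lemma ext1_zero_left_gorenstein (M Q : lmodType A) :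
  left_gorenstein A -> gorenstein_projective (Res M) -> projective Q ->
  ext1_zero M Q.
Proof.
move=> [n lgA] gM pQ.
apply: (@ext1_zero_cosyzygy _ (fun Z => gorenstein_projective (Res Z)) n) => //.
  exact: res_gproj_cosyzygy.
move=> Z; have [m [rZ _] mn] := lgA Z.
exact/(gproj_resolution_ext_zero pQ)/(gproj_resolution_widen mn).
Qed.
End Frobenius.

(** * Averaging over a separability element *)

Section Averaging.
Variables (R A : pzRingType) (iota : {rmorphism R -> A}).
Local Notation Res := (restrict_scalars iota).
Variables (X Y : lmodType A) (g : {linear Res X -> Res Y}).

(** The action of the A-bimodule of tensors on R-linear maps between A-modules; it
is well defined because R-linear maps absorb the balancing relation. *)
Definition average (t : tensor iota) (x : X) : Y :=
  tensor_lift (fun a b => a *: (g (b *: x) : Y)) t.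

Fact balanced_average x : balanced iota (fun a b => a *: (g (b *: x) : Y)).
Proof.
split=> [a a' b|a b b'|a r b]; first by rewrite scalerDl.
  by rewrite scalerDl linearD scalerDr.
by rewrite -[in RHS]scalerA -[g _ in RHS]/(g (r *: (b *: x : Res X))) linearZ_LR
  scalerA.
Qed.

Lemma average_tens a b x : average (tens iota a b) x = a *: (g (b *: x) : Y).
Proof. exact: (tensor_liftE (balanced_average x)). Qed.

Lemma averageB t u x : average (t - u) x = average t x - average u x.
Proof. exact: (tensor_lift_additive (balanced_average x)). Qed.

Lemma average0 x : average 0 x = 0.
Proof. by rewrite -(subrr 0) averageB subrr. Qed.

Lemma averageD t x y : average t (x + y) = average t x + average t y.
Proof.
elim/tensor_ind: t => [|t u tE uE|a b]; first by rewrite !average0 addr0.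
  by rewrite !averageB tE uE opprD addrACA.
by rewrite !average_tens scalerDr linearD scalerDr.
Qed.

Lemma average_actl c t x : average (tensor_actl c t) x = c *: average t x.
Proof.
have actB := tensor_lift_additive (balanced_actl iota c).
elim/tensor_ind: t => [|t u tE uE|a b].
- by rewrite -[X in tensor_actl c X](subrr 0) [tensor_actl _ _]actB subrr
  !average0 scaler0.
- by rewrite [tensor_actl _ _]actB !averageB tE uE scalerBr.
- by rewrite tensor_actlE !average_tens scalerA.
Qed.

Lemma average_actr c t x : average (tensor_actr t c) x = average t (c *: x).
Proof.
have actB := tensor_lift_additive (balanced_actr iota c).
elim/tensor_ind: t => [|t u tE uE|a b].
- by rewrite -[X in tensor_actr X c](subrr 0) [tensor_actr _ _]actB subrr
  !average0.
- by rewrite [tensor_actr _ _]actB !averageB tE uE.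
- by rewrite tensor_actrE !average_tens scalerA.
Qed.

(** Where g is already A-linear, averaging only multiplies by the image of t in
A. *)
Lemma average_fixed (K : lmodType A)
    (k : {linear K -> X}) (f : {linear K -> Y}) t x :
  (forall z, g (k z) = f z) -> average t (k x) = tensor_mul t *: f x.
Proof.
move=> gk; have mulB := tensor_lift_additive (balanced_mul iota).
elim/tensor_ind: t => [|t u tE uE|a b].
- by rewrite -[X in tensor_mul X](subrr 0) [tensor_mul _]mulB subrr average0
  scale0r.
- by rewrite [tensor_mul _]mulB averageB tE uE scalerBl.
- by rewrite tensor_mulE average_tens -linearZ_LR gk linearZ_LR scalerA.
Qed.
End Averaging.

(** The section s of the multiplication provides t = s 1 with c t = t c and
image 1. Averaging an R-linear extension g of f over t makes it A-linear, by the
first property, and still an extension of f, by the second. *)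
Lemma ext1_zero_separable (R A : pzRingType) (iota : {rmorphism R -> A})
    (M Q : lmodType A) :
  separable_extension iota ->
  ext1_zero (restrict_scalars iota M) (restrict_scalars iota Q) ->
    ext1_zero M Q.
Proof.
move=> [s [sl sr smul]] eM K X k e se f.
have [g gE] := eM _ _ _ _ (short_exact_res iota se) (res_map iota f).
have gL : linear (average g (s 1)).
  by move=> a u v; rewrite averageD -average_actr -sr mul1r -[a]mulr1 sl
    average_actl mulr1.
exists (linear_of gL) => x.
by rewrite linear_ofE (average_fixed (f := f)) // smul scale1r.
Qed.

Theorem theoremA (R A : pzRingType) (iota : {rmorphism R -> A})
    (iota_inj : injective iota) (frobR : frobenius_extension iota)
    (M : lmodType A) :
  (gorenstein_projective M -> gorenstein_projective (restrict_scalars iota M)) /\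
  (left_gorenstein_frobenius_extension iota \/
     separable_frobenius_extension iota ->
   gorenstein_projective (restrict_scalars iota M) -> gorenstein_projective M).
Proof.
split; first exact: gorenstein_projective_res.
move=> extA; apply: gorenstein_projective_of_res => // {}M Q gM pQ.
case: extA => [[_ lgA]|[_ sepA]].
  exact: (ext1_zero_left_gorenstein frobR).
apply/(ext1_zero_separable sepA)/gorenstein_projective_ext1 => //.
exact: projective_res.
Qed.
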